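(* Let $H:\mathbb{R}^n\to\mathbb{R}$ and $g:\mathbb{R}^n\to\mathbb{R}$ be continuously differentiable functions such that: (i) $H$ is strictly convex and has $L_H$-Lipschitz continuous gradient: $\|\nabla H(p_1)-\nabla H(p_2)\|\le L_H\|p_1-p_2\|$ for all $p_1,p_2\in\mathbb{R}^n$; (ii) $g$ is convex and has $L_g$-Lipschitz continuous gradient: $\|\nabla g(y_1)-\nabla g(y_2)\|\le L_g\|y_1-y_2\|$ for all $y_1,y_2\in\mathbb{R}^n$. For $x\in\mathbb{R}^n$ and $t>0$ define $F:\mathbb{R}^n\to\mathbb{R}^n$ by $$F(y):=x-t\,\nabla H(\nabla g(y)).$$ Then, for any $x\in\mathbb{R}^n$ and any $t>0$ satisfying $t\,L_H\,L_g<1$, the iteration $$y^{(k+1)}=F(y^{(k)}),\qquad k=0,1,2,\dots,$$ started from any $y^{(0)}\in\mathbb{R}^n$, converges to the unique global minimizer over $y\in\mathbb{R}^n$ of the Hopf--Lax functional $$y\mapsto t\,H^*\!\left(\frac{x-y}{t}\right)+g(y).$$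
   Context: $\|\cdot\|$ denotes the Euclidean ($L^2$) norm on $\mathbb{R}^n$. $H^*$ denotes the Legendre transform (convex conjugate) of $H$, $H^*(q)=\sup_{p\in\mathbb{R}^n}\{p^\top q-H(p)\}$, which may take the value $+\infty$. The Hopf--Lax formula is $u(x,t)=\inf_{y\in\mathbb{R}^n}\{t\,H^*((x-y)/t)+g(y)\}$. *)

(* Defs.v *)
From HB Require Import structures.
From mathcomp Require Import all_boot all_order all_algebra.
From mathcomp Require Import all_classical all_reals all_analysis.

Set Implicit Arguments.
Unset Strict Implicit.
Unset Printing Implicit Defensive.

Import Order.TTheory GRing.Theory Num.Theory.
Import numFieldNormedType.Exports.

Local Open Scope classical_set_scope.
Local Open Scope ring_scope.
Local Open Scope convex_scope.

(* R^n is 'rV[R]_n. Its library norm `|v| is the sup norm, hence the separate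
   Euclidean norm; differentiability, continuity and convergence are those of
   the library, the two norms being equivalent. *)

Definition dotv (R : realType) (n : nat) (p q : 'rV[R]_n) : R :=
  \sum_(i < n) p 0 i * q 0 i.

Definition norm2 (R : realType) (n : nat) (v : 'rV[R]_n) : R :=
  Num.sqrt (dotv v v).

Definition grad (R : realType) (n : nat) (f : 'rV[R]_n -> R) (y : 'rV[R]_n) :
    'rV[R]_n :=
  \row_(i < n) 'D_(delta_mx 0 i) f y.

Definition continuously_differentiable (R : realType) (n : nat)
    (f : 'rV[R]_n -> R) : Prop :=
  (forall y, differentiable f y) /\ continuous (grad f).

Definition lipschitz_gradient (R : realType) (n : nat) (L : R)
    (f : 'rV[R]_n -> R) : Prop :=
  forall y1 y2, norm2 (grad f y1 - grad f y2) <= L * norm2 (y1 - y2).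

(* Strict counterpart of the library's [convex_function] on the whole space. *)
Definition strictly_convex_function (R : realType) (E : lmodType R)
    (E' := convex_lmodType E) (f : E' -> R^o) : Prop :=
  forall (t : {i01 R}) (x y : E'), 0 < t%:num < 1 -> x <> y ->
    f (x <| t |> y) < f x <| t |> f y :> R.

Definition legendre (R : realType) (n : nat) (H : 'rV[R]_n -> R)
    (q : 'rV[R]_n) : \bar R :=
  ereal_sup (range (fun p : 'rV[R]_n => (dotv p q - H p)%:E)).

(* The sum is never of the form -oo + g y: [legendre H q >= - H 0 > -oo]. For
   [0 < t] the library's product satisfies [t%:E * +oo = +oo]. *)
Definition hopf_lax_functional (R : realType) (n : nat) (H g : 'rV[R]_n -> R)
    (x : 'rV[R]_n) (t : R) (y : 'rV[R]_n) : \bar R :=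
  (t%:E * legendre H (t^-1 *: (x - y)) + (g y)%:E)%E.

Definition global_minimizer (R : realType) (T : Type) (J : T -> \bar R)
    (y : T) : Prop :=
  forall z, (J y <= J z)%E.

Definition fixed_point_map (R : realType) (n : nat) (H g : 'rV[R]_n -> R)
    (x : 'rV[R]_n) (t : R) (y : 'rV[R]_n) : 'rV[R]_n :=
  x - t *: grad H (grad g y).

(* Main.v *)
From HB Require Import structures.
Require Import Defs.
From mathcomp Require Import all_boot all_order all_algebra.
From mathcomp Require Import lra.
From mathcomp Require Import all_classical all_reals all_analysis.
Import Order.TTheory GRing.Theory Num.Theory.
Import numFieldNormedType.Exports.

(** The minimizer is the fixed point of [F y = x - t grad H (grad g y)], and
    [F] is a contraction for the Euclidean norm, with ratio [t LH Lg] in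
    positive dimension ([fixed_point_map_contraction]).

    A fixed point is a minimizer by convex duality ([hopf_lax_fixed_point]).
    Let [y] be a fixed point, [p = grad g y] and [q_z = (x - z) / t], so that
    [q_y = grad H p]. The Fenchel inequality [H^*(q_z) >= p . q_z - H p] bounds
    the functional at every [z] from below by
      [m z = p . (x - z) - t H p + g z],
    and the gradient inequality of the convex function [g] at [y] gives
    [m y <= m z]. At [y] itself the Fenchel inequality is an equality, because
    [q_y] is the gradient of the convex function [H] at [p]
    ([legendre_grad]): the functional takes there its lower bound [m y].

    Conversely, if [z] is a minimizer, then its value is at most [m y <= m z],
    so the Fenchel inequality is also an equality at [q_z]. This makes [p] a
    maximizer of [p' . q_z - H p'], whence [q_z = grad H p = q_y] by
    differentiability of [H] at [p] ([legendre_le_grad]), and [z = y].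

    Convergence has to be shown for the sup norm, for which [F] itself need
    not be contracting. By equivalence of the two norms the iterates of [F]
    are nevertheless Lipschitz with constants [sqrt n * q ^ k], [q < 1], which
    is enough for a globally attracting fixed point
    ([iter_contraction_cvg]). *)

Local Open Scope classical_set_scope.
Local Open Scope ring_scope.
Local Open Scope convex_scope.

Set Implicit Arguments.
Unset Strict Implicit.
Unset Printing Implicit Defensive.

(** * Euclidean inner product and norm *)

Lemma dotvC (R : realType) n (u v : 'rV[R]_n) : dotv u v = dotv v u.
Proof. by apply: eq_bigr => i _; rewrite mulrC. Qed.

Lemma dotvBr (R : realType) n (u v w : 'rV[R]_n) :
  dotv u (v - w) = dotv u v - dotv u w.
Proof. by rewrite -sumrB; apply: eq_bigr => i _; rewrite !mxE mulrBr. Qed.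

Lemma dotvBl (R : realType) n (u v w : 'rV[R]_n) :
  dotv (u - v) w = dotv u w - dotv v w.
Proof. by rewrite !(dotvC _ w) dotvBr. Qed.

Lemma dotvZr (R : realType) n (c : R) (u v : 'rV[R]_n) :
  dotv u (c *: v) = c * dotv u v.
Proof. by rewrite mulr_sumr; apply: eq_bigr => i _; rewrite !mxE mulrCA. Qed.

Lemma dotvDZl (R : realType) n (c : R) (u v w : 'rV[R]_n) :
  dotv (u + c *: v) w = dotv u w + c * dotv v w.
Proof.
rewrite mulr_sumr -big_split; apply: eq_bigr => i _ /=.
by rewrite !mxE mulrDl mulrA.
Qed.

Lemma norm2_ge0 (R : realType) n (v : 'rV[R]_n) : 0 <= norm2 v.
Proof. exact: sqrtr_ge0. Qed.

Lemma norm2Z (R : realType) n (c : R) (v : 'rV[R]_n) :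
  norm2 (c *: v) = `|c| * norm2 v.
Proof.
by rewrite /norm2 dotvZr dotvC dotvZr mulrA -expr2 sqrtrM ?sqr_ge0// sqrtr_sqr.
Qed.

Lemma coord_le_mx_norm (R : realType) n (v : 'rV[R]_n) i : `|v 0 i| <= `|v|.
Proof.
rewrite [leRHS]mx_normrE.
exact: (le_bigmax _ (fun ij : 'I_1 * 'I_n => `|v ij.1 ij.2|) (0, i)).
Qed.

Lemma mx_norm_le_norm2 (R : realType) n (v : 'rV[R]_n) : `|v| <= norm2 v.
Proof.
rewrite [leLHS]mx_normrE; apply/bigmax_leP; split; first exact: norm2_ge0.
move=> [i j] _ /=; rewrite ord1 -sqrtr_sqr ler_wsqrtr//.
rewrite /dotv (bigD1 j)//= -expr2 lerDl sumr_ge0// => k _.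
by rewrite -expr2 sqr_ge0.
Qed.

Lemma norm2_le_mx_norm (R : realType) n (v : 'rV[R]_n) :
  norm2 v <= Num.sqrt n%:R * `|v|.
Proof.
rewrite -[X in _ * X]normr_id -sqrtr_sqr -sqrtrM ?ler0n// ler_wsqrtr//.
rewrite mulr_natl -[X in _ *+ X]card_ord -sumr_const ler_sum// => i _.
by rewrite -expr2 -real_normK ?num_real// lerXn2r ?nnegrE// coord_le_mx_norm.
Qed.

(** * Fixed points of eventually contracting maps *)

(** Joins the completeness of the uniform structure of matrices to their
    normed module structure, so that fixed point theorems apply to row
    vectors. *)
HB.instance Definition _ (R : realType) (m n : nat) :=
  Complete.on 'M[R]_(m, n).

(** Some iterate [F^m] is a contraction, because [C * q ^+ m] tends to [0], and
    its fixed point [p] is fixed by [F] too: [F p] is another fixed point of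
    [F^m], which has only one. The same estimate with [b = p] shows that every
    orbit tends to [p]. The constant [C] allows for a map that contracts an
    equivalent norm only. *)
Lemma iter_contraction_cvg (R : realType) (X : completeNormedModType R)
    (F : X -> X) (C q : R) :
  0 <= q < 1 ->
  (forall k a b, `|iter k F a - iter k F b| <= C * q ^+ k * `|a - b|) ->
  exists2 p, F p = p & forall y0, iter k F y0 @[k --> \oo] --> p.
Proof.
move=> /andP[q0 q1] FC.
have cvg0 (D : R) : D * q ^+ k @[k --> \oo] --> 0.
  by apply: cvg_geometric; rewrite ger0_norm.
have cvgF p : F p = p -> forall y0, iter k F y0 @[k --> \oo] --> p.
  move=> Fp y0; apply/subr_cvg0/norm_cvg0P.
  have Fkp k : iter k F p = p by elim: k => //= k ->.
  apply: (@squeeze_cvgr _ _ _ _ (fun=> 0) (fun k => C * `|y0 - p| * q ^+ k)).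
  - near=> k; rewrite normr_ge0/= mulrAC -[in leLHS](Fkp k).
    exact: FC.
  - exact: cvg_cst.
  - exact: cvg0.
suff [p Fp] : exists p, F p = p by exists p => //; exact: cvgF.
have [m Cm] : exists m, C * q ^+ m < 1.
  have /cvgr0Pnorm_lt/(_ 1 ltr01)[N _ HN] := cvg0 C.
  by exists N; rewrite (le_lt_trans (ler_norm _))//; apply: (HN N) => /=.
have Fm_fun : {homo iter m F : x / [set: X] x >-> [set: X] x} by [].
(* A contraction ratio is nonnegative by type, while [C] may be negative. *)
have C0 : 0 <= Num.max 0 (C * q ^+ m) by rewrite le_max lexx.
have ctr : is_contraction (mkfun Fm_fun).
  exists (NngNum C0); split; first by rewrite /= gt_max ltr01.
  move=> [a b] _ /=; apply: le_trans (FC m a b) _.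
  by rewrite ler_wpM2r// le_max lexx orbT.
have [p _ Fmp] := banach_fixed_point ctr closedT (ex_intro _ (0 : X) I).
exists p.
apply: (contraction_fixpoint_unique ctr) => //.
rewrite -[RHS]/(iter m F (F p)) -iterSr iterS.
by congr F; exact: Fmp.
Unshelve. all: end_near. Qed.

(** * First-order conditions *)

Lemma dotv_gradE (R : realType) n (f : 'rV[R]_n -> R) y v :
  differentiable f y -> dotv (grad f y) v = 'D_v f y.
Proof.
move=> df; rewrite deriveE// [in RHS](row_sum_delta v) linear_sum.
apply: eq_bigr => i _.
by rewrite linearZ/= mxE deriveE// mulrC.
Qed.

(** Convexity and maximality only control difference quotients with a positive
    increment, so that the derivative is approached from the right. *)
Lemma cvg_right_quotient (R : realType) n (f : 'rV[R]_n -> R) y v :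
  differentiable f y ->
  h^-1 * (f (y + h *: v) - f y) @[h --> 0^'+] --> dotv (grad f y) v.
Proof.
move=> df; rewrite dotv_gradE//; apply: cvg_dnbhs_at_right.
have dfv : derivable f y v := diff_derivable df.
suff -> : (fun h => h^-1 * (f (y + h *: v) - f y)) =
    (fun h => h^-1 *: ((f \o shift y) (h *: v) - f y)) by exact: dfv.
by apply/funext => h /=; rewrite (addrC y).
Qed.

(** Convexity on the segment from [y] to [z] says that the difference quotients
    of [f] at [y] in the direction [z - y] are at most [f z - f y] for positive
    increments up to [1]; the directional derivative is their limit. *)
Lemma convex_grad_le (R : realType) n (f : 'rV[R]_n -> R) y z :
  convex_function [set: convex_lmodType 'rV[R]_n] f -> differentiable f y ->
  f y + dotv (grad f y) (z - y) <= f z.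
Proof.
move=> cf df; rewrite -lerBrDl.
apply: (cvgr_to_le (cvg_right_quotient df)).
near=> h.
have h0 : 0 < h by [].
have h1 : h <= 1 by near: h; apply: nbhs_right_le.
have := cf (Itv01 (ltW h0) h1) z y (in_setT _) (in_setT _).
have -> : (z : convex_lmodType _) <| Itv01 (ltW h0) h1 |> y = y + h *: (z - y).
  change (h *: z + (1 - h) *: y = y + h *: (z - y)).
  by rewrite scalerBl scale1r scalerBr addrCA addrA.
rewrite convRE/= /unstable.onem => fh.
by rewrite ler_pdivrMl//; lra.
Unshelve. all: end_near. Qed.

(** First-order condition at a maximum of [p' . q - f p']: the derivative of [f]
    at [p] in every direction [v] is at least [v . q]. For
    [v = q - grad f p] this says that the Euclidean norm of [v] vanishes. *)
Lemma affine_support_grad (R : realType) n (f : 'rV[R]_n -> R) p q :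
  differentiable f p -> (forall p', dotv p' q - f p' <= dotv p q - f p) ->
  q = grad f p.
Proof.
move=> df max.
have grad_ge v : dotv v q <= dotv (grad f p) v.
  apply: (cvgr_to_ge (cvg_right_quotient df)).
  near=> h.
  have h0 : 0 < h by [].
  rewrite ler_pdivlMl//.
  by have := max (p + h *: v); rewrite dotvDZl; lra.
apply/eqP; rewrite -subr_eq0 -normr_le0.
rewrite (le_trans (mx_norm_le_norm2 _))//.
have := grad_ge (q - grad f p); rewrite dotvC -subr_le0 -dotvBl => le0.
by rewrite /norm2 ler0_sqrtr.
Unshelve. all: end_near. Qed.

(** * Legendre transform *)

Lemma fenchel_inequality (R : realType) n (f : 'rV[R]_n -> R) p q :
  ((dotv p q - f p)%:E <= legendre f q)%E.
Proof. by apply: ereal_sup_ubound; exists p. Qed.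

(** The gradient inequality of [f] at [p] says exactly that [p] maximizes
    [p' . grad f p - f p'], so the supremum is attained there. *)
Lemma legendre_grad (R : realType) n (f : 'rV[R]_n -> R) p :
  convex_function [set: convex_lmodType 'rV[R]_n] f -> differentiable f p ->
  legendre f (grad f p) = (dotv p (grad f p) - f p)%:E.
Proof.
move=> cf df; apply/eqP; rewrite eq_le fenchel_inequality andbT.
apply: ge_ereal_sup => _ [p' _ <-]; rewrite lee_fin.
have := convex_grad_le p' cf df.
by rewrite dotvBr !(dotvC (grad f p)); lra.
Qed.

(** The equality case of the Fenchel inequality. The hypothesis makes [p] a
    maximizer of [p' . q - f p'], and the first-order condition there
    determines [q]; uniqueness of the minimizer comes from this. *)
Lemma legendre_le_grad (R : realType) n (f : 'rV[R]_n -> R) p q :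
  differentiable f p -> (legendre f q <= (dotv p q - f p)%:E)%E ->
  q = grad f p.
Proof.
move=> df le; apply: affine_support_grad => // p'.
by rewrite -lee_fin; apply: le_trans le; exact: fenchel_inequality.
Qed.

Lemma strictly_convex_convex (R : realType) n (f : 'rV[R]_n -> R) :
  strictly_convex_function f ->
  convex_function [set: convex_lmodType 'rV[R]_n] f.
Proof.
move=> sf t a b _ _.
have [<-|ab] := pselect (a = b); first by rewrite !convmm.
have [->|t0] := eqVneq t 0%:i01; first by rewrite !conv0.
have [->|t1] := eqVneq t 1%:i01; first by rewrite !conv1.
apply/ltW/sf => //.
by rewrite !lt_neqAle ge0 le1 !andbT eq_sym t0 t1.
Qed.

(** * The Hopf-Lax functional and its fixed point map *)

(** [m] bounds the functional from below, by the Fenchel inequality at the one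
    slope [p], touches it at [ystar] and is itself minimal there. A second
    minimizer would also give equality in the Fenchel inequality, which
    determines its slope. *)
Lemma hopf_lax_fixed_point (R : realType) n (H g : 'rV[R]_n -> R) x t ystar :
  convex_function [set: convex_lmodType 'rV[R]_n] H ->
  convex_function [set: convex_lmodType 'rV[R]_n] g ->
  (forall p, differentiable H p) -> (forall y, differentiable g y) ->
  0 < t -> fixed_point_map H g x t ystar = ystar ->
  unique (global_minimizer (hopf_lax_functional H g x t)) ystar.
Proof.
move=> cH cg dH dg t0 Fy.
pose p := grad g ystar.
pose m y := t * (dotv p (t^-1 *: (x - y)) - H p) + g y.
have slope : t^-1 *: (x - ystar) = grad H p.
  by rewrite -Fy /fixed_point_map subKr scalerA mulVf ?scale1r ?gt_eqF.
have Jstar : hopf_lax_functional H g x t ystar = (m ystar)%:E.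
  by rewrite /hopf_lax_functional /m slope legendre_grad// -EFinM -EFinD.
have mJ y : ((m y)%:E <= hopf_lax_functional H g x t y)%E.
  rewrite /m EFinD EFinM; apply: leeD2r; apply: lee_wpmul2l.
    by rewrite lee_fin ltW.
  exact: fenchel_inequality.
have m_min y : m ystar <= m y.
  have := convex_grad_le y cg (dg ystar); rewrite -/p /m !mulrBr.
  by rewrite !dotvZr !mulrA mulfV ?gt_eqF// !mul1r !dotvBr; lra.
split=> [y|y miny].
  by rewrite Jstar; apply: le_trans (mJ y); rewrite lee_fin.
have : (legendre H (t^-1 *: (x - y)) <= (dotv p (t^-1 *: (x - y)) - H p)%:E)%E.
  have : (hopf_lax_functional H g x t y <= (m y)%:E)%E.
    by rewrite (le_trans (miny ystar))// Jstar lee_fin.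
  by rewrite /hopf_lax_functional /m EFinD EFinM leeD2rE// lee_pmul2l.
move=> /(legendre_le_grad (dH p)); rewrite -slope.
have tV0 : t^-1 != 0 by rewrite invr_eq0 gt_eqF.
by move=> /(scalerI tV0)/addrI/oppr_inj ->.
Qed.

(** A nonzero vector forces both Lipschitz constants to be nonnegative, so that
    the two estimates compose with ratio [t * LH * Lg]. Without one, in
    dimension [0], the constants may be negative, and the ratio is [0]. *)
Lemma fixed_point_map_contraction (R : realType) n (H g : 'rV[R]_n -> R)
    LH Lg x t :
  lipschitz_gradient LH H -> lipschitz_gradient Lg g ->
  0 < t -> t * LH * Lg < 1 ->
  exists2 q : R, 0 <= q < 1 & forall a b,
    norm2 (fixed_point_map H g x t a - fixed_point_map H g x t b) <=
    q * norm2 (a - b).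
Proof.
move=> lH lg t0 tL.
have [[v v0]|zero] := pselect (exists v : 'rV[R]_n, v != 0); last first.
  exists 0; first by rewrite lexx ltr01.
  move=> a b; have -> : a = b.
    apply/eqP; rewrite -subr_eq0; apply/negP => /negP ab.
    by apply: zero; exists (a - b).
  by rewrite subrr /norm2 /dotv big1 ?sqrtr0 ?mul0r// => i _; rewrite mxE mul0r.
have v2 : 0 < norm2 v by rewrite (lt_le_trans _ (mx_norm_le_norm2 v))// normr_gt0.
have L_ge0 (L : R) (f : 'rV[R]_n -> R) : lipschitz_gradient L f -> 0 <= L.
  move=> /(_ v 0); rewrite subr0 => /(le_trans (norm2_ge0 _)).
  by rewrite pmulr_lge0.
have LH0 := L_ge0 _ _ lH; have Lg0 := L_ge0 _ _ lg.
exists (t * LH * Lg); first by rewrite tL !mulr_ge0// ltW.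
move=> a b; rewrite /fixed_point_map opprB addrC addrA subrK -scalerBr.
rewrite norm2Z gtr0_norm// -!mulrA ler_pM2l//.
have -> : norm2 (grad H (grad g b) - grad H (grad g a)) =
          norm2 (grad H (grad g a) - grad H (grad g b)).
  by rewrite -opprB -scaleN1r norm2Z normrN1 mul1r.
by apply: (le_trans (lH _ _)); rewrite ler_wpM2l.
Qed.

Theorem theorem2p1 (R : realType) (n : nat) (H g : 'rV[R]_n -> R) (LH Lg : R)
    (H_C1 : continuously_differentiable H)
    (g_C1 : continuously_differentiable g)
    (H_strictly_convex : strictly_convex_function H)
    (H_lipschitz : lipschitz_gradient LH H)
    (g_convex : convex_function [set: convex_lmodType 'rV[R]_n] g)
    (g_lipschitz : lipschitz_gradient Lg g)
    (x : 'rV[R]_n) (t : R) (t_gt0 : 0 < t) (t_small : t * LH * Lg < 1) :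
  exists ystar : 'rV[R]_n,
    unique (global_minimizer (hopf_lax_functional H g x t)) ystar /\
    forall y0 : 'rV[R]_n,
      iter k (fixed_point_map H g x t) y0 @[k --> \oo] --> ystar.
Proof.
have [q q01 Fq] :=
  fixed_point_map_contraction x H_lipschitz g_lipschitz t_gt0 t_small.
have iterq k a b : norm2 (iter k (fixed_point_map H g x t) a -
    iter k (fixed_point_map H g x t) b) <= q ^+ k * norm2 (a - b).
  elim: k => [|k IH]; first by rewrite expr0 mul1r.
  rewrite /= exprS -mulrA (le_trans (Fq _ _))// ler_wpM2l//.
  by case/andP: q01.
have [k a b|ystar Fy cvgF] := @iter_contraction_cvg R 'rV[R]_n
    (fixed_point_map H g x t) (Num.sqrt n%:R) q q01.
  rewrite (le_trans (mx_norm_le_norm2 _))// (le_trans (iterq k a b))//.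
  rewrite mulrAC mulrC ler_wpM2r ?exprn_ge0//; first by case/andP: q01.
  exact: norm2_le_mx_norm.
exists ystar; split => //.
apply: hopf_lax_fixed_point => //; last 2 first.
- exact: H_C1.1.
- exact: g_C1.1.
exact: strictly_convex_convex.
Qed.
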